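(* Let $n\geq 1$, let $(\mathbf{d},\mathbf{r})$ be an arithmetical structure on the star graph $S_n$, and let $\mathcal{K}(S_n;\mathbf{d},\mathbf{r})$ be its critical group. Then \[\mathcal{K}(S_n;\mathbf{d},\mathbf{r})\oplus (\mathbb{Z}/r_0\mathbb{Z})^2 \cong \bigoplus_{i=1}^n \mathbb{Z}/d_i\mathbb{Z},\] where $r_0=\operatorname{lcm}(d_1, d_2, \dotsc, d_n)$.
   Context: An arithmetical structure on a finite, connected, loopless graph $G$ with vertex set $V(G)$ is a pair $(\mathbf{d},\mathbf{r})$, where $\mathbf{r}=(r_v)_{v\in V(G)}$ consists of positive integers with no common factor, $\mathbf{d}=(d_v)_{v\in V(G)}$ consists of nonnegative integers, and for every vertex $v$ we have $r_vd_v=\sum r_u$, the sum being over all $u$ adjacent to $v$ (with multiplicity for multigraphs). Its critical group $\mathcal{K}(G;\mathbf{d},\mathbf{r})$ is the torsion part of the cokernel (over $\mathbb{Z}$) of the matrix $L(G,\mathbf{d})=\operatorname{diag}(\mathbf{d})-A(G)$, where $A(G)$ is the adjacency matrix of $G$. The star graph $S_n$ has $n$ leaves $v_1,\dotsc,v_n$, each joined by one edge to a central vertex $v_0$ (and no other edges). Write $d_i=d_{v_i}$ and $r_i=r_{v_i}$; in particular $r_0$ is the $\mathbf{r}$-value at the central vertex, and it equals $\operatorname{lcm}(d_1,\dotsc,d_n)$. *)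

(* Defs.v *)
From HB Require Import structures.
From mathcomp Require Import all_boot all_order all_algebra.
From mathcomp Require Import boolp.

Set Implicit Arguments.
Unset Strict Implicit.
Unset Printing Implicit Defensive.

Import GRing.Theory.
Local Open Scope ring_scope.

Definition zmod_iso (U V : zmodType) : Prop :=
  exists f : {additive U -> V}, bijective f.

(* The zmodType structure on dependent finite products: for a family over a
   finite index type, this is the direct sum. *)
Section DirectSum.
Variables (I : finType) (T : I -> zmodType).
Implicit Types f g h : {dffun forall i, T i}.

Definition dffun_zero : {dffun forall i, T i} := [ffun i => 0 : T i].
Definition dffun_opp f : {dffun forall i, T i} := [ffun i => - f i : T i].
Definition dffun_add f g : {dffun forall i, T i} := [ffun i => f i + g i : T i].

Fact dffun_addA : associative dffun_add.
Proof. by move=> f g h; apply/ffunP=> i; rewrite !ffunE addrA. Qed.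
Fact dffun_addC : commutative dffun_add.
Proof. by move=> f g; apply/ffunP=> i; rewrite !ffunE addrC. Qed.
Fact dffun_add0 : left_id dffun_zero dffun_add.
Proof. by move=> f; apply/ffunP=> i; rewrite !ffunE add0r. Qed.
Fact dffun_addN : left_inverse dffun_zero dffun_opp dffun_add.
Proof. by move=> f; apply/ffunP=> i; rewrite !ffunE addNr. Qed.

HB.instance Definition _ := GRing.isZmodule.Build {dffun forall i, T i}
  dffun_addA dffun_addC dffun_add0 dffun_addN.
End DirectSum.

Definition direct_sum (I : finType) (T : I -> zmodType) : zmodType :=
  {dffun forall i, T i}.

(* Z/mZ for every m, including Z/0Z = Z and the trivial group Z/1Z, which the
   ordinal-based 'Z_m does not provide. *)
Definition Zquot (m : nat) : zmodType := Quotient.quot (GRing.ZmodClosed.clone int (dvdz m%:Z) _).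

Section Torsion.
Variable V : zmodType.

Definition torsion : {pred V} :=
  [pred x | `[< exists2 k : nat, (0 < k)%N & x *+ k = 0 >]].

Fact torsion_closed : zmod_closed torsion.
Proof.
split=> [|x y /asboolP[k k0 xk] /asboolP[l l0 yl]]; apply/asboolP.
  by exists 1%N.
exists (k * l)%N; first by rewrite muln_gt0 k0.
by rewrite mulrnBl mulrnA xk mul0rn mulnC mulrnA yl mul0rn subrr.
Qed.

HB.instance Definition _ :=
  GRing.isZmodClosed.Build V torsion torsion_closed.

Record torsion_of := TorsionOf { torsion_val : V; _ : torsion_val \in torsion }.

HB.instance Definition _ := [isSub for torsion_val].
HB.instance Definition _ := [Choice of torsion_of by <:].
HB.instance Definition _ := [SubChoice_isSubZmodule of torsion_of by <:].
End Torsion.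

Section Cokernel.
Variables (m n : nat) (M : 'M[int]_(m, n)).

Definition mx_image : {pred 'cV[int]_m} :=
  [pred y | `[< exists x : 'cV[int]_n, y = M *m x >]].

Fact mx_image_closed : zmod_closed mx_image.
Proof.
split=> [|_ _ /asboolP[x ->] /asboolP[y ->]]; apply/asboolP.
  by exists 0; rewrite mulmx0.
by exists (x - y); rewrite mulmxBr.
Qed.

HB.instance Definition _ :=
  GRing.isZmodClosed.Build 'cV[int]_m mx_image mx_image_closed.

Definition cokernel : zmodType := Quotient.quot (GRing.ZmodClosed.clone _ mx_image _).
End Cokernel.

(* Finite connected loopless multigraphs with vertex set 'I_N, given by their
   adjacency matrix: [adj u v] is the number of edges joining u and v. *)
Record multigraph (N : nat) := Multigraph {
  adj : 'M[nat]_N;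
  adj_nonempty : (0 < N)%N;
  adj_sym : forall u v, adj u v = adj v u;
  adj_loopless : forall v, adj v v = 0%N;
  adj_connected : forall u v, connect (fun x y => (0 < adj x y)%N) u v
}.

Definition arithmetical_structure (N : nat) (G : multigraph N)
    (d r : 'I_N -> nat) : Prop :=
  [/\ forall v, (0 < r v)%N,
      (\big[gcdn/0]_(v < N) r v = 1)%N &
      forall v, (r v * d v = \sum_(u < N) adj G v u * r u)%N].

Definition laplacian (N : nat) (G : multigraph N) (d : 'I_N -> nat) :
    'M[int]_N :=
  diag_mx (\row_v (d v)%:Z) - map_mx Posz (adj G).

(* The critical group of (d, r) on G; r does not enter the construction. *)
Definition critical_group (N : nat) (G : multigraph N) (d : 'I_N -> nat) :
    zmodType :=
  torsion_of (cokernel (laplacian G d)).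

(* The star with n leaves: the central vertex is ord0 and the leaves are
   [lift ord0 i] for i : 'I_n. *)
Definition star_adj (n : nat) : 'M[nat]_n.+1 :=
  \matrix_(u, v) nat_of_bool ((u == ord0) (+) (v == ord0)).

Fact star_sym n u v : star_adj n u v = star_adj n v u.
Proof. by rewrite !mxE addbC. Qed.

Fact star_loopless n v : star_adj n v v = 0%N.
Proof. by rewrite mxE addbb. Qed.

Fact star_connected n u v :
  connect (fun x y => (0 < star_adj n x y)%N) u v.
Proof.
have c0 w : connect (fun x y => (0 < star_adj n x y)%N) w ord0.
  have [->|w0] := eqVneq w ord0; first exact: connect0.
  by apply: connect1; rewrite mxE (negPf w0) eqxx.
apply: (connect_trans (c0 u)).
by rewrite sym_connect_sym // => x y; rewrite star_sym.
Qed.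

Definition star (n : nat) : multigraph n.+1 :=
  Multigraph (ltn0Sn n) (@star_sym n) (@star_loopless n) (@star_connected n).

(* Main.v *)
(* Fix integers c_i with sum c_i r_i = 1 over the leaves, and for z in Z^n put
   rho z = sum r_i z_i and psi z = sum c_i r_i z_i.  The critical group is the
   group of vectors orthogonal to r modulo the image of the Laplacian, so
   z |-> ([(0, z - rho z *: c)], rho z, psi z) maps Z^n to K + (Z/r_0)^2.  Since
   r_i d_i = r_0 and sum r_i = r_0 d_0, this map is onto and its kernel is
   prod d_i Z, which is also the kernel of Z^n -> sum Z/d_i. *)
Require Import Defs.
From HB Require Import structures.
From mathcomp Require Import all_boot all_order all_algebra.
From mathcomp Require Import boolp ring.

Set Implicit Arguments.
Unset Strict Implicit.
Unset Printing Implicit Defensive.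

Import GRing.Theory Num.Theory.
Local Open Scope ring_scope.

(** * Quotient groups and Bezout coefficients *)

Lemma pi_quot_eq0 (V : zmodType) (I : zmodClosed V) (x : V) :
  (\pi_(Quotient.quot I) x == 0)%qT = (x \in I).
Proof. by rewrite -[0](@pi_zeror V _ 0 -%R +%R) -Quotient.idealrBE subr0. Qed.

(** Both targets are the quotient of [U] by the common kernel. The isomorphism is [g] after a
    section of [f]; it is additive because equal [f]-values force equal [g]-values. *)
Lemma zmod_iso_same_kernel (U V W : zmodType)
    (f : {additive U -> V}) (g : {additive U -> W}) :
  (forall y, exists x, f x = y) -> (forall z, exists x, g x = z) ->
  (forall x, f x = 0 <-> g x = 0) -> zmod_iso V W.
Proof.
move=> fS gS ker.
have fS' y : exists x, f x == y by have [x <-] := fS y; exists x.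
have gS' z : exists x, g x == z by have [x <-] := gS z; exists x.
pose f' y := xchoose (fS' y); pose g' z := xchoose (gS' z).
have f'K y : f (f' y) = y by apply/eqP; apply: (xchooseP (fS' y)).
have g'K z : g (g' z) = z by apply/eqP; apply: (xchooseP (gS' z)).
have gf x y : f x = f y -> g x = g y.
  by move/eqP; rewrite -subr_eq0 -raddfB => /eqP/ker/eqP; rewrite raddfB subr_eq0 => /eqP.
have fg x y : g x = g y -> f x = f y.
  by move/eqP; rewrite -subr_eq0 -raddfB => /eqP/ker/eqP; rewrite raddfB subr_eq0 => /eqP.
have hB : zmod_morphism (g \o f').
  by move=> x y /=; rewrite -raddfB; apply: gf; rewrite raddfB !f'K.
exists (HB.pack_for {additive V -> W} (g \o f')
  (GRing.isZmodMorphism.Build V W (g \o f') hB)).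
exists (f \o g') => [y|z] /=.
  by rewrite (fg _ (f' y)).
by rewrite (gf _ (g' z)).
Qed.

Lemma Bezout_biggcdn (I : finType) (r : I -> nat) :
  exists c : I -> int, \sum_i c i * (r i)%:Z = (\big[gcdn/0%N]_i r i)%:Z.
Proof.
apply: (big_ind (fun g => exists c : I -> int, \sum_i c i * (r i)%:Z = g%:Z)).
- by exists (fun=> 0); rewrite big1 // => i _; rewrite mul0r.
- move=> a b [ca ea] [cb eb]; have [u [v euv]] := Bezoutz a b.
  exists (fun i => u * ca i + v * cb i).
  under eq_bigr do rewrite mulrDl -!mulrA.
  by rewrite big_split /= -!mulr_sumr ea eb euv.
move=> i _; exists (fun j => (j == i)%:R); rewrite (bigD1 i) //= eqxx mul1r.
by rewrite big1 ?addr0 // => j /negPf->; rewrite mul0r.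
Qed.

(** * The star Laplacian and the arithmetic of [r] *)

Lemma star_laplacian_center n (d : 'I_n.+1 -> nat) (x : 'cV[int]_n.+1) :
  (laplacian (star n) d *m x) ord0 0 =
  (d ord0)%:Z * x ord0 0 - \sum_(i < n) x (lift ord0 i) 0.
Proof.
rewrite /laplacian mulmxBl mul_diag_mx !mxE; congr (_ - _).
rewrite big_ord_recl /= !mxE eqxx mul0r add0r.
by apply: eq_bigr => i _; rewrite !mxE mul1r.
Qed.

Lemma star_laplacian_leaf n (d : 'I_n.+1 -> nat) (x : 'cV[int]_n.+1) i :
  (laplacian (star n) d *m x) (lift ord0 i) 0 =
  (d (lift ord0 i))%:Z * x (lift ord0 i) 0 - x ord0 0.
Proof.
rewrite /laplacian mulmxBl mul_diag_mx !mxE; congr (_ - _).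
rewrite big_ord_recl /= !mxE mul1r big1 ?addr0 // => j _.
by rewrite !mxE mul0r.
Qed.

Section Structure.
Variables (n : nat) (d r : 'I_n.+1 -> nat).
Hypothesis hdr : arithmetical_structure (star n) d r.
Local Notation L := (laplacian (star n) d).
Local Notation leaf i := (lift ord0 i).

Lemma star_leaf_eq i : (r (leaf i) * d (leaf i) = r ord0)%N.
Proof.
case: hdr => _ _ ->; rewrite big_ord_recl /= !mxE mul1n big1 ?addn0 // => j _.
by rewrite !mxE mul0n.
Qed.

Lemma star_center_eq : (r ord0 * d ord0 = \sum_(i < n) r (leaf i))%N.
Proof.
case: hdr => _ _ ->; rewrite big_ord_recl /= !mxE mul0n add0n.
by apply: eq_bigr => j _; rewrite !mxE mul1n.
Qed.

(** As [n > 0], some leaf exists and its [r]-value divides [r ord0]. Hence the gcd of the leaf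
    values already divides [r ord0], and dropping the centre from the overall gcd, which is 1, does
    not change it. *)
Lemma star_leaf_Bezout : (0 < n)%N ->
  exists c : 'I_n -> int, \sum_i c i * (r (leaf i))%:Z = 1.
Proof.
move=> n0; have [c hc] := Bezout_biggcdn (fun i => r (leaf i)).
exists c; rewrite hc; apply: (congr1 Posz).
case: hdr => _ + _; rewrite big_ord_recl => <-.
apply/esym/gcdn_idPr; rewrite -(star_leaf_eq (Ordinal n0)) dvdn_mulr //.
exact: biggcdn_inf.
Qed.

Lemma star_center_lcm : (0 < n)%N -> r ord0 = \big[lcmn/1%N]_(i < n) d (leaf i).
Proof.
move=> n0; apply/eqP; rewrite eqn_dvd; apply/andP; split; last first.
  by apply/dvdn_biglcmP => i _; rewrite -(star_leaf_eq i) dvdn_mull.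
set l := \big[_/_]_i _; have [c hc] := star_leaf_Bezout n0.
suff: ((r ord0)%:Z %| l%:Z)%Z by [].
(* Write [l] as the sum of [c i * r_i * l]: since [d_i] divides [l], each [r_i * l] is a multiple of
   [r_i * d_i = r_0]. *)
rewrite -[l%:Z]mul1r -hc mulr_suml; apply: rpred_sum => i _.
rewrite -mulrA; apply: dvdz_mull; rewrite -PoszM -(star_leaf_eq i).
by apply: dvdn_mul => //; apply: (biglcmn_sup i).
Qed.

(** * The image of the Laplacian and the torsion of its cokernel *)

Let R := (r ord0)%:Z.

Lemma star_leaf_eqz i : (r (leaf i))%:Z * (d (leaf i))%:Z = R.
Proof. by rewrite -PoszM star_leaf_eq. Qed.

Lemma star_center_eqz : R * (d ord0)%:Z = \sum_(i < n) (r (leaf i))%:Z.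
Proof. by rewrite -PoszM star_center_eq -natz natr_sum; under eq_bigr do rewrite natz. Qed.

(** The Laplacian is symmetric, and the structure equations say that it kills [r]. *)
Lemma star_laplacian_orth (x : 'cV[int]_n.+1) : \sum_v (r v)%:Z * (L *m x) v 0 = 0.
Proof.
rewrite big_ord_recl.
under eq_bigr do rewrite star_laplacian_leaf mulrBr mulrA star_leaf_eqz.
rewrite star_laplacian_center sumrB -mulr_suml -mulr_sumr -star_center_eqz -/R; ring.
Qed.

Lemma star_image_of_orth_scaled (x : 'cV[int]_n.+1) :
  \sum_v (r v)%:Z * x v 0 = 0 -> x *+ r ord0 \in mx_image L.
Proof.
rewrite big_ord_recl => hx; apply/asboolP.
(* With centre coordinate 0, leaf row [i] gives [d_i * r_i * x_i = r_0 * x_i]; the centre row gives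
   minus the sum of the [r_i * x_i], which is [r_0 * x_0] by orthogonality. *)
exists (\col_v (if unlift ord0 v is Some i then (r (leaf i))%:Z * x (leaf i) 0 else 0)).
apply/colP => v; rewrite mulmxnE -mulr_natl natz; case: (unliftP ord0 v) => [i|] ->.
  rewrite star_laplacian_leaf !mxE liftK unlift_none subr0.
  by rewrite mulrA [_ * (r _)%:Z]mulrC star_leaf_eqz.
rewrite star_laplacian_center !mxE unlift_none mulr0 sub0r.
under eq_bigr do rewrite mxE liftK.
by apply/eqP; rewrite -addr_eq0 hx.
Qed.

(** A nonzero multiple lying in the image is orthogonal to [r], and the integers have no torsion;
    conversely [r ord0] kills the class of every orthogonal vector. *)
Lemma star_torsionP (x : 'cV[int]_n.+1) :
  reflect (\sum_v (r v)%:Z * x v 0 = 0) (\pi_(cokernel L)%qT x \in @torsion (cokernel L)).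
Proof.
apply: (iffP (asboolP _)) => [[k k0]|hx]; last first.
  exists (r ord0); first by case: hdr.
  apply/eqP; rewrite -raddfMn pi_quot_eq0; exact: star_image_of_orth_scaled.
rewrite -raddfMn => /eqP; rewrite pi_quot_eq0 => /asboolP[y hy].
have := star_laplacian_orth y; rewrite -hy.
under eq_bigr do rewrite mulmxnE mulrnAr.
by rewrite sumrMnl => /eqP; rewrite mulrn_eq0 -[k == _]negbK -lt0n k0 => /eqP.
Qed.

Lemma star_image_embed (z : 'cV[int]_n.+1) (t : int) (y : 'I_n -> int) :
  z ord0 0 = (d ord0)%:Z * t - \sum_i y i ->
  (forall i, z (leaf i) 0 = (d (leaf i))%:Z * y i - t) -> z \in mx_image L.
Proof.
move=> z0 zl; apply/asboolP.
exists (\col_v (if unlift ord0 v is Some i then y i else t)).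
apply/colP => v; case: (unliftP ord0 v) => [i|] ->.
  by rewrite star_laplacian_leaf !mxE liftK unlift_none zl.
rewrite star_laplacian_center !mxE unlift_none z0; congr (_ - _).
by apply: eq_bigr => i _; rewrite mxE liftK.
Qed.

Lemma star_image_coords (z : 'cV[int]_n.+1) : z \in mx_image L ->
  exists t, exists y : 'I_n -> int,
    z ord0 0 = (d ord0)%:Z * t - \sum_i y i /\
    forall i, z (leaf i) 0 = (d (leaf i))%:Z * y i - t.
Proof.
case/asboolP => x ->; exists (x ord0 0), (fun i => x (leaf i) 0).
by split=> [|i]; rewrite (star_laplacian_center, star_laplacian_leaf).
Qed.

(** * The two surjections from Z^n and their common kernel *)

Variable c : 'I_n -> int.
Hypothesis hc : \sum_i c i * (r (leaf i))%:Z = 1.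

Let rho (z : 'cV[int]_n) : int := \sum_i (r (leaf i))%:Z * z i 0.
Let psi (z : 'cV[int]_n) : int := \sum_i c i * ((r (leaf i))%:Z * z i 0).
Let proj (z : 'cV[int]_n) : 'cV[int]_n.+1 :=
  \col_v (if unlift ord0 v is Some i then z i 0 - c i * rho z else 0).

Let proj0 z : proj z ord0 0 = 0.
Proof. by rewrite mxE unlift_none. Qed.

Let projS z i : proj z (leaf i) 0 = z i 0 - c i * rho z.
Proof. by rewrite mxE liftK. Qed.

Let rhoB : zmod_morphism rho.
Proof. by move=> x y; rewrite -sumrB; apply: eq_bigr => i _; rewrite !mxE mulrBr. Qed.

Let psiB : zmod_morphism psi.
Proof. by move=> x y; rewrite -sumrB; apply: eq_bigr => i _; rewrite !mxE !mulrBr. Qed.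

Let projB : zmod_morphism proj.
Proof.
move=> x y; apply/colP => v; rewrite !mxE.
by case: (unlift ord0 v) => [i|]; rewrite ?subr0 // !mxE rhoB; ring.
Qed.

Let proj_orth z : \sum_v (r v)%:Z * proj z v 0 = 0.
Proof.
rewrite big_ord_recl proj0 mulr0 add0r.
under eq_bigr => i _ do rewrite projS mulrBr mulrCA mulrA.
by rewrite sumrB -mulr_suml hc mul1r subrr.
Qed.

Let proj_torsion z : \pi_(cokernel L)%qT (proj z) \in @torsion (cokernel L).
Proof. exact/star_torsionP/proj_orth. Qed.

Let to_sum (z : 'cV[int]_n) :
    critical_group (star n) d * (Zquot (r ord0) * Zquot (r ord0)) :=
  (TorsionOf (proj_torsion z),
   (\pi_(Zquot (r ord0))%qT (rho z), \pi_(Zquot (r ord0))%qT (psi z))).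

Let to_sumB : zmod_morphism to_sum.
Proof.
move=> x y; congr (_, (_, _)).
- by apply: val_inj; rewrite /= projB !raddfB.
- by rewrite rhoB raddfB.
by rewrite psiB raddfB.
Qed.

Let to_leaves (z : 'cV[int]_n) : direct_sum (fun i : 'I_n => Zquot (d (leaf i))) :=
  [ffun i : 'I_n => \pi_(Zquot (d (leaf i)))%qT (z i 0)].

Let to_leavesB : zmod_morphism to_leaves.
Proof. by move=> x y; apply/ffunP => i; rewrite !ffunE !mxE raddfB. Qed.

Let to_leaves_eq0 z :
  to_leaves z = 0 <-> forall i, ((d (leaf i))%:Z %| (z i 0)%R)%Z.
Proof.
split=> [/ffunP h i|h].
  by have /eqP := h i; rewrite !ffunE pi_quot_eq0.
by apply/ffunP => i; rewrite !ffunE; apply/eqP; rewrite pi_quot_eq0; apply: h.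
Qed.

Let to_sum_eq0 z : to_sum z = 0 <->
  [/\ proj z \in mx_image L, (R %| rho z)%Z & (R %| psi z)%Z].
Proof.
split=> [[/eqP h1 /eqP h2 /eqP h3]|[h1 h2 h3]].
  by move: h1 h2 h3; rewrite !pi_quot_eq0.
congr (_, (_, _)); first apply: val_inj.
all: by apply/eqP; rewrite pi_quot_eq0.
Qed.

Let ker_eq z : to_sum z = 0 <-> to_leaves z = 0.
Proof.
rewrite to_sum_eq0 to_leaves_eq0; split; last first.
  move=> h; pose y i := ((z i 0)%R %/ (d (leaf i))%:Z)%Z.
  have zE i : z i 0 = (d (leaf i))%:Z * y i by rewrite mulrC divzK.
  have rz i : (r (leaf i))%:Z * z i 0 = R * y i.
    by rewrite zE mulrA star_leaf_eqz.
  have rhoE : rho z = R * \sum_i y i.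
    by rewrite mulr_sumr; apply: eq_bigr.
  split; last 1 first.
  - by apply: rpred_sum => i _; rewrite rz dvdz_mull ?dvdz_mulr.
  - pose Y := \sum_i y i.
    (* Multiplying by [d_i] turns the correction [c i * r_i * Y] into [c i * R * Y = c i * rho z],
       as [proj] requires; the corrections sum to [Y], so the centre row vanishes. *)
    apply: (@star_image_embed _ 0 (fun i => y i - c i * (r (leaf i))%:Z * Y)).
      by rewrite proj0 sumrB -mulr_suml hc mul1r mulr0 subrr subr0.
    move=> i; rewrite projS rhoE zE -(star_leaf_eqz i) -/Y; ring.
  by rewrite rhoE dvdz_mulr.
case=> /star_image_coords [t [y [y0 yS]]] /dvdzP[m hm] /dvdzP[m' hm'] i.
have zE j : z j 0 = (d (leaf j))%:Z * y j - t + c j * (m * R).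
  by rewrite -hm -yS projS subrK.
(* Weighting the leaf equations by [c j * r_j] and summing isolates [t], because the weights sum to
   1. The left side becomes [psi z], so divisibility of [psi z] by [R] passes to [t]. *)
pose q := \sum_j (c j * y j + m * (c j * c j * (r (leaf j))%:Z)).
have tE : t = R * q - psi z.
  rewrite -[LHS]mul1r -hc mulr_suml mulr_sumr -sumrB.
  by apply: eq_bigr => j _; rewrite zE -(star_leaf_eqz j); ring.
have Rt : (R %| t)%Z.
  rewrite tE hm'; apply: rpredB; [exact: dvdz_mulr|exact: dvdz_mull].
have dR : ((d (leaf i))%:Z %| R)%Z by rewrite -(star_leaf_eqz i) dvdz_mull.
rewrite zE; apply: rpredD; last by do 2!apply: dvdz_mull.
by apply: rpredB; [exact: dvdz_mulr|exact: dvdz_trans Rt].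
Qed.

Let to_leaves_surj y : exists z, to_leaves z = y.
Proof.
exists (\col_i repr (y i)); apply/ffunP => i.
by rewrite ffunE mxE reprK.
Qed.

Let to_sum_surj y : exists z, to_sum z = y.
Proof.
case: y => -[k kt] [a b].
pose x : 'cV[int]_n.+1 := repr k.
have hx : \sum_v (r v)%:Z * x v 0 = 0.
  by apply/star_torsionP; rewrite reprK.
pose A := repr a; pose B := repr b; pose x0 := x ord0 0.
(* The central coordinate of [x] is moved to the leaves along [c], so that orthogonality to [r]
   becomes [rho u = 0]. *)
pose u : 'cV[int]_n := \col_i (x (leaf i) 0 + R * x0 * c i).
have rhou : rho u = 0.
  rewrite -hx big_ord_recl /rho.
  under eq_bigr do rewrite mxE mulrDr mulrCA [_ * c _]mulrC.
  by rewrite big_split /= -mulr_sumr hc mulr1 addrC.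
pose cv : 'cV[int]_n := \col_i c i.
(* Adding [A] times [c] brings [rho] to [A]. Adding a constant [s] to all leaves then shifts [psi]
   by [s] but [rho] only by a multiple of [r_0], so [s] is free to bring [psi] to [B]. *)
pose s := B - psi u - A * psi cv.
pose z : 'cV[int]_n := \col_i (u i 0 + A * c i + s).
have rhoz : rho z = A + s * (R * (d ord0)%:Z).
  transitivity (rho u + A * 1 + s * (R * (d ord0)%:Z)); last by rewrite rhou; ring.
  rewrite star_center_eqz -hc !mulr_sumr -!big_split /=.
  by apply: eq_bigr => i _; rewrite !mxE; ring.
have psiz : psi z = B.
  transitivity (psi u + A * psi cv + s * 1); last by rewrite /s; ring.
  rewrite -hc !mulr_sumr -!big_split /=.
  by apply: eq_bigr => i _; rewrite !mxE; ring.
exists z; congr (_, (_, _)).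
- apply: val_inj => /=; rewrite -[RHS]reprK -/x; apply/eqP.
  rewrite -subr_eq0 -raddfB pi_quot_eq0.
  (* On the leaves [proj z - x] is [s + c i * R * (x0 - s * d_0)]. The centre value [- s] yields the
     constant, and [R = r_i * d_i] yields the leaf values, whose sum [x0 - s * d_0] fits the centre
     row. *)
  apply: (@star_image_embed _ (- s)
    (fun i => c i * (r (leaf i))%:Z * (x0 - s * (d ord0)%:Z))).
    rewrite -mulr_suml hc !mxE unlift_none /x0; ring.
  move=> i; rewrite 2!mxE liftK rhoz !mxE -(star_leaf_eqz i); ring.
- apply/eqP; rewrite -[a]reprK -subr_eq0 -raddfB pi_quot_eq0 rhoz -/A addrC addKr.
  by apply/dvdz_mull/dvdz_mulr.
by rewrite psiz reprK.
Qed.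

Lemma star_critical_group_iso :
  zmod_iso (critical_group (star n) d * (Zquot (r ord0) * Zquot (r ord0)))%type
    (direct_sum (fun i : 'I_n => Zquot (d (leaf i)))).
Proof.
exact: (@zmod_iso_same_kernel _ _ _
  (HB.pack_for {additive _ -> _} to_sum (GRing.isZmodMorphism.Build _ _ to_sum to_sumB))
  (HB.pack_for {additive _ -> _} to_leaves (GRing.isZmodMorphism.Build _ _ to_leaves to_leavesB))
  to_sum_surj to_leaves_surj ker_eq).
Qed.
End Structure.
Local Close Scope ring_scope.

Theorem theorem1 (n : nat) (hn : (1 <= n)%N) (d r : 'I_n.+1 -> nat)
    (hdr : arithmetical_structure (star n) d r) :
  r ord0 = (\big[lcmn/1]_(i < n) d (lift ord0 i))%N /\
  zmod_iso
    (critical_group (star n) d * (Zquot (r ord0) * Zquot (r ord0)))%type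
    (direct_sum (fun i : 'I_n => Zquot (d (lift ord0 i)))).
Proof.
split; first exact: star_center_lcm hdr hn.
have [c hc] := star_leaf_Bezout hdr hn.
exact (star_critical_group_iso hdr hc).
Qed.
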